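(* Let $n \geq 2$ and let $(x_i,y_i)_{i=1}^n$ be labeled examples with $x_i \in \mathbb{R}^d$, $y_i \in \{-1,+1\}$ and $\max_i\|x_i\| \leq 1$. Let $X = [x_1,\dots,x_n]\in\mathbb{R}^{d\times n}$ and let $\sigma^2 \geq \frac{1}{n}\|X\|^2$ (spectral norm). Let $\lambda > 0$, $b\in\{1,\dots,n\}$, $T \geq 1$, and $\beta_b := 1 + \frac{(b-1)(n\sigma^2-1)}{n-1}$. Consider the SVM primal objective $$P(w) := \frac{1}{n}\sum_{i=1}^n \max\{0, 1 - y_i\langle w, x_i\rangle\} + \frac{\lambda}{2}\|w\|^2.$$ Run mini-batched Pegasos: set $w^{(1)} = 0$; for $t = 1,\dots,T$, draw $A_t$ uniformly at random among subsets of $\{1,\dots,n\}$ of cardinality $b$ (independently across iterations), set $\eta_t = \frac{1}{\lambda t}$, $A_t^+ = \{i\in A_t : y_i\langle w^{(t)},x_i\rangle < 1\}$, and $$w^{(t+1)} = (1-\eta_t\lambda) w^{(t)} + \frac{\eta_t}{b}\sum_{i\in A_t^+} y_i x_i.$$ Let $\bar{w}^{(T)} = \frac{2}{T}\sum_{t=\lfloor T/2\rfloor+1}^T w^{(t)}$. Then $$\mathbb{E}\big[P(\bar{w}^{(T)})\big] - \inf_{w\in\mathbb{R}^d} P(w) \leq \frac{\beta_b}{b}\cdot\frac{30}{\lambda T}.$$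
   Context: $\|X\|$ is the spectral norm (largest singular value) of $X$. The expectation is over the random mini-batches. *)

(* Defs.v *)
From HB Require Import structures.
From mathcomp Require Import all_boot all_order all_algebra.
From mathcomp Require Import boolp classical_sets reals.
Set Implicit Arguments. Unset Strict Implicit. Unset Printing Implicit Defensive.
Import Order.TTheory GRing.Theory Num.Theory.
Local Open Scope ring_scope.


Section Pegasos.
Variables (R : realType) (d n : nat).

Definition dotv (m : nat) (u v : 'cV[R]_m) : R := \sum_(k < m) u k 0 * v k 0.
Definition vnorm (m : nat) (u : 'cV[R]_m) : R := Num.sqrt (dotv u u).

Definition datamx (x : 'I_n -> 'cV[R]_d) : 'M[R]_(d, n) :=
  \matrix_(k < d, i < n) x i k 0.

Definition specnorm (p q : nat) (X : 'M[R]_(p, q)) : R :=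
  sup [set vnorm (X *m v) | v in [set v : 'cV[R]_q | vnorm v <= 1]%classic]%classic.

Definition svmP (lam : R) (x : 'I_n -> 'cV[R]_d) (y : 'I_n -> R)
  (w : 'cV[R]_d) : R :=
  n%:R^-1 * (\sum_(i < n) Num.max 0 (1 - y i * dotv w (x i)))
  + lam / 2 * vnorm w ^+ 2.

(* One mini-batched Pegasos step at iteration t (1-based) with batch A. *)
Definition peg_step (lam : R) (b : nat) (x : 'I_n -> 'cV[R]_d) (y : 'I_n -> R)
  (t : nat) (A : {set 'I_n}) (w : 'cV[R]_d) : 'cV[R]_d :=
  let eta := (lam * t%:R)^-1 in
  (1 - eta * lam) *: w
  + (eta / b%:R) *: \sum_(i in A | y i * dotv w (x i) < 1) (y i *: x i).

(* w_iter t = w^{(t)} (1-based; w_iter 0 is an unused dummy),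
   with w^{(1)} = 0 and w^{(t+1)} = step t (w^{(t)}) (A t). *)
Fixpoint w_iter (lam : R) (b : nat) (x : 'I_n -> 'cV[R]_d) (y : 'I_n -> R)
  (A : nat -> {set 'I_n}) (t : nat) : 'cV[R]_d :=
  match t with
  | 0 => 0
  | t'.+1 => if t' is 0 then 0
             else peg_step lam b x y t' (A t') (w_iter lam b x y A t')
  end.

(* Batch schedule: A_t = om (t-1) for 1 <= t <= T. *)
Definition sched (T : nat) (om : {ffun 'I_T -> {set 'I_n}}) (t : nat)
  : {set 'I_n} :=
  match @insub nat (fun k => k < T)%N _ t.-1 with
  | Some i => om i | None => finset.set0 end.

Definition wbar (lam : R) (b : nat) (x : 'I_n -> 'cV[R]_d) (y : 'I_n -> R)
  (T : nat) (om : {ffun 'I_T -> {set 'I_n}}) : 'cV[R]_d :=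
  (2 / T%:R) *: \sum_(T./2 + 1 <= t < T.+1) w_iter lam b x y (sched om) t.

(* Sample space: T independent uniform draws of b-subsets = uniform on
   the set of all T-tuples of b-subsets. *)
Definition batches (b T : nat) : {set {ffun 'I_T -> {set 'I_n}}} :=
  [set om : {ffun 'I_T -> {set 'I_n}} | [forall t, #|om t| == b]].

Definition exp_obj (lam : R) (b : nat) (x : 'I_n -> 'cV[R]_d) (y : 'I_n -> R)
  (T : nat) : R :=
  #|batches b T|%:R^-1 *
  \sum_(om in batches b T) svmP lam x y (wbar lam b x y om).

End Pegasos.

(* Main.v *)
Require Import Defs.
From HB Require Import structures.
From mathcomp Require Import all_boot all_order all_algebra.
From mathcomp Require Import boolp classical_sets reals.
From mathcomp Require Import zify ring lra.
Set Implicit Arguments. Unset Strict Implicit. Unset Printing Implicit Defensive.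
Import Order.TTheory GRing.Theory Num.Theory.
Local Open Scope ring_scope.

(* Let h_A be the batch hinge subgradient and G2 = beta_b / b. Counting how often
   an index, resp. a pair of indices, is drawn gives E |h_A|^2 <= G2, and lam w_t
   is a convex combination of past h_A, so E |lam w_t - h_A|^2 <= 4 G2. With
   a_t = E |w_t - w|^2, one step gives
     E P(w_t) - P(w) <= lam/2 ((t-1) a_t - t a_{t+1}) + 2 G2 / (lam t).
   If P(w) <= inf P + delta, strong convexity at midpoints turns this into
   t a_{t+1} <= 8 G2 / lam^2 + 4 t delta / lam; telescoping over t > T/2 and
   Jensen's inequality then give 12 G2 / (lam T) + 2 delta. For odd T the average
   has total weight 1 + 1/T, which costs at most 3 G2 / (lam T) more. Finally
   delta -> 0, so no minimizer of P is needed. *)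

(** * Euclidean inner product on column vectors *)

Section DotProduct.
Variables (R : realType) (m : nat).
Implicit Types (u v w : 'cV[R]_m) (a : R).

Lemma dotvC u v : dotv u v = dotv v u.
Proof. by apply: eq_bigr => k _; rewrite mulrC. Qed.

Lemma dotvDl u v w : dotv (u + v) w = dotv u w + dotv v w.
Proof. by rewrite -big_split; apply: eq_bigr => k _; rewrite mxE mulrDl. Qed.

Lemma dotvZl a u w : dotv (a *: u) w = a * dotv u w.
Proof. by rewrite mulr_sumr; apply: eq_bigr => k _; rewrite mxE mulrA. Qed.

Lemma dotvDr u v w : dotv w (u + v) = dotv w u + dotv w v.
Proof. by rewrite dotvC dotvDl !(dotvC w). Qed.

Lemma dotvZr a u w : dotv w (a *: u) = a * dotv w u.
Proof. by rewrite dotvC dotvZl dotvC. Qed.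

Lemma dotvNl u w : dotv (- u) w = - dotv u w.
Proof. by rewrite -scaleN1r dotvZl mulN1r. Qed.

Lemma dotvNr u w : dotv w (- u) = - dotv w u.
Proof. by rewrite dotvC dotvNl dotvC. Qed.

Lemma dotv0l w : dotv 0 w = 0.
Proof. by rewrite -(scale0r (0 : 'cV_m)) dotvZl mul0r. Qed.

Lemma dotv_suml (I : Type) (r : seq I) (P : pred I) (F : I -> 'cV[R]_m) w :
  dotv (\sum_(i <- r | P i) F i) w = \sum_(i <- r | P i) dotv (F i) w.
Proof.
by apply: (big_morph (fun u => dotv u w)) => [u v|]; rewrite ?dotvDl ?dotv0l.
Qed.

Lemma dotv_ge0 u : 0 <= dotv u u.
Proof. by apply: sumr_ge0 => k _; rewrite -expr2 sqr_ge0. Qed.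

Lemma sqr_vnorm u : vnorm u ^+ 2 = dotv u u.
Proof. by rewrite sqr_sqrtr ?dotv_ge0. Qed.

Lemma vnorm_le u a : 0 <= a -> (vnorm u <= a) = (dotv u u <= a ^+ 2).
Proof.
by move=> a0; rewrite -sqr_vnorm ler_pXn2r // ?nnegrE ?sqrtr_ge0.
Qed.

Definition dotvE := (dotvDl, dotvDr, dotvZl, dotvZr, dotvNl, dotvNr).

Lemma dotvB_sqr u v :
  dotv (u - v) (u - v) = dotv u u + (-2 * dotv u v + dotv v v).
Proof. by rewrite !dotvE [dotv v u]dotvC; ring. Qed.

Lemma dotv_sum_sqr (I : finType) (P : pred I) (F : I -> 'cV[R]_m) :
  dotv (\sum_(i | P i) F i) (\sum_(i | P i) F i)
  = \sum_(i | P i) \sum_(j | P j) dotv (F i) (F j).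
Proof.
rewrite dotv_suml; apply: eq_bigr => i _.
by rewrite dotvC dotv_suml; apply: eq_bigr => j _; rewrite dotvC.
Qed.

End DotProduct.

(** * The spectral norm as an operator norm *)

Lemma has_ubound_specnorm (R : realType) (p q : nat) (X : 'M[R]_(p, q)) :
  has_ubound [set vnorm (X *m v) | v in [set v : 'cV[R]_q | vnorm v <= 1]]%classic.
Proof.
pose r k := dotv (row k X)^T (row k X)^T.
(* Crude bound: for v in the unit ball, |row k +- v|^2 >= 0 gives |<row k, v>| <= [r k + 1]. The set
   is thus bounded, so its [sup] is a genuine supremum. *)
pose M := \sum_(k < p) (r k + 1) ^+ 2.
exists (M + 1) => _ [v /= v1 <-].
have M0 : 0 <= M by apply: sumr_ge0 => k _; exact: sqr_ge0.
rewrite vnorm_le ?addr_ge0 //; apply: (@le_trans _ _ M); last by nra.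
apply: ler_sum => k _; rewrite -expr2.
have -> : (X *m v) k 0 = dotv (row k X)^T v.
  by rewrite mxE; apply: eq_bigr => i _; rewrite !mxE.
move: v1; rewrite vnorm_le // expr1n => v1.
have /= := dotv_ge0 ((row k X)^T + v); have /= := dotv_ge0 ((row k X)^T - v).
have /= := dotv_ge0 v; have /= := dotv_ge0 (row k X)^T.
rewrite !dotvE (dotvC v) -/(r k); set z := dotv (row k X)^T v; set c := dotv v v in v1 *.
move=> r0 c0 rm rp; have : 0 <= (r k + 1 - z) * (r k + 1 + z).
  by apply: mulr_ge0; lra.
by rewrite -subr_ge0; congr (0 <= _); ring.
Qed.

(** Dividing v by a puts it in the unit ball over which [specnorm] is taken. *)
Lemma dotv_mulmx_le (R : realType) (p q : nat) (X : 'M[R]_(p, q)) v (a : R) :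
  0 < a -> dotv v v <= a ^+ 2 ->
  dotv (X *m v) (X *m v) <= (specnorm X * a) ^+ 2.
Proof.
move=> a0 va.
have S1 : vnorm (X *m (a^-1 *: v)) <= specnorm X.
  apply: ub_le_sup; first exact: has_ubound_specnorm.
  exists (a^-1 *: v) => //=.
  rewrite vnorm_le // !dotvE expr1n mulrA -invfM -expr2.
  by rewrite ler_pdivrMl ?exprn_gt0 // mulr1.
have S0 : 0 <= specnorm X by apply: le_trans S1; exact: sqrtr_ge0.
move: S1; rewrite vnorm_le // -scalemxAr !dotvE mulrA -invfM -expr2.
by rewrite ler_pdivrMl ?exprn_gt0 // exprMn mulrC.
Qed.

(** * Uniform averages over a finite set *)

Section Average.
Variables (R : realFieldType) (I : finType).
Implicit Types (D : {set I}) (f g : I -> R).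

Definition avg D f : R := #|D|%:R^-1 * \sum_(i in D) f i.

Lemma avgD D f g : avg D (fun i => f i + g i) = avg D f + avg D g.
Proof. by rewrite /avg big_split mulrDr. Qed.

Lemma avgZ D (a : R) f : avg D (fun i => a * f i) = a * avg D f.
Proof. by rewrite /avg -mulr_sumr mulrCA. Qed.

Lemma avgB D f g : avg D (fun i => f i - g i) = avg D f - avg D g.
Proof. by rewrite /avg sumrB mulrBr. Qed.

Lemma avg_sum (J : Type) (r : seq J) (P : pred J) D (F : J -> I -> R) :
  avg D (fun i => \sum_(j <- r | P j) F j i) = \sum_(j <- r | P j) avg D (F j).
Proof. by rewrite /avg exchange_big mulr_sumr. Qed.

Lemma avg_cst D (a : R) : (0 < #|D|)%N -> avg D (fun=> a) = a.
Proof.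
move=> D0; rewrite /avg sumr_const -[a *+ _]mulr_natl mulrA mulVf ?mul1r //.
by rewrite pnatr_eq0 -lt0n.
Qed.

Lemma le_avg D f g : {in D, forall i, f i <= g i} -> avg D f <= avg D g.
Proof. by move=> fg; rewrite ler_wpM2l ?invr_ge0 ?ler0n // ler_sum. Qed.

Lemma eq_avg D f g : {in D, f =1 g} -> avg D f = avg D g.
Proof. by move=> fg; rewrite /avg; congr (_ * _); exact: eq_bigr. Qed.

End Average.

(** * First and second moments of a uniformly drawn b-subset *)

Section Draws.
Import mathcomp.boot.finset.
Variables (R : realFieldType) (T : finType).

(** Removing B is a bijection onto the (b - |B|)-subsets of the complement of B, with inverse the
    union with B. *)
Lemma card_draws_sup (B : {set T}) (b : nat) : (#|B| <= b)%N ->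
  #|[set A : {set T} | (B \subset A) && (#|A| == b)]|
  = 'C(#|T| - #|B|, b - #|B|).
Proof.
move=> Bb; have -> : (#|T| - #|B|)%N = #|~: B| by rewrite [RHS]cardsCs setCK.
rewrite -cards_draws.
rewrite -[RHS](@card_in_imset _ _ (setU B)) => [|C C']; last first.
  rewrite !inE => /andP[CB _] /andP[CB' _] /(congr1 (fun A : {set T} => A :\: B)).
  rewrite !setDUl !setDv !set0U !setDE.
  by move: CB CB' => /setIidPl-> /setIidPl->.
apply: eq_card => A; rewrite !inE; apply/andP/imsetP => [[BA /eqP Ab]|[C]].
  exists (A :\: B); last by rewrite setDE setUIr setUCr setIT; apply/esym/setUidPr.
  rewrite inE setDE subsetIr -setDE cardsDS // Ab eqxx //.
rewrite !inE => /andP[CB /eqP Cb] ->; split; first exact: subsetUl.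
have : B :&: C = set0 by apply/disjoint_setI0; rewrite disjoint_sym disjoints_subset.
by move=> dBC; rewrite cardsU dBC cards0 subn0 Cb subnKC.
Qed.

Lemma sum_indicator (I : finType) (D : {set I}) (P : pred I) :
  \sum_(i in D) (P i)%:R = #|[pred i in D | P i]|%:R :> R.
Proof.
rewrite -sum1_card natr_sum big_mkcondr; apply: eq_bigr => i _.
by case: (P i).
Qed.

Definition draws (b : nat) : {set {set T}} := [set A : {set T} | #|A| == b].

Lemma draws_gt0 (b : nat) : (b <= #|T|)%N -> (0 < #|draws b|)%N.
Proof. by move=> bT; rewrite card_draws bin_gt0. Qed.

(** The probability is C(n-1, b-1) / C(n, b), evaluated by n C(n-1, b-1) = b C(n, b). *)
Lemma avg_draws_mem (b : nat) (i : T) : (0 < b <= #|T|)%N ->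
  avg (draws b) (fun A => (i \in A)%:R) = b%:R / #|T|%:R :> R.
Proof.
move=> /andP[b0 bT]; rewrite /avg sum_indicator.
have -> : #|[pred A in draws b | i \in A]| = 'C(#|T|.-1, b.-1).
  have := @card_draws_sup [set i] b; rewrite cards1 !subn1 => <- //.
  by apply: eq_card => A; rewrite !inE sub1set andbC.
have T0 : (0 < #|T|)%N by exact: leq_trans bT.
rewrite card_draws; have := mul_bin_diag #|T| b.-1.
rewrite prednK // => /(congr1 (fun k => k%:R : R)); rewrite !natrM => E.
have n0 : #|T|%:R != 0 :> R by rewrite pnatr_eq0 -lt0n.
have C0 : 'C(#|T|, b)%:R != 0 :> R by rewrite pnatr_eq0 -lt0n bin_gt0.
apply: (mulfI C0); rewrite mulrA divff // mul1r mulrA; apply: (mulIf n0).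
by rewrite divfK // mulrC E mulrC.
Qed.

Lemma avg_draws_mem2 (b : nat) (i j : T) : (0 < b <= #|T|)%N -> i != j ->
  avg (draws b) (fun A => ((i \in A) && (j \in A))%:R)
  = b%:R * (b%:R - 1) / (#|T|%:R * (#|T|%:R - 1)) :> R.
Proof.
move=> /andP[b0 bT] ij; rewrite /avg sum_indicator.
have T2 : (2 <= #|T|)%N.
  by apply/card_gt1P; exists i, j.
have n0 : #|T|%:R != 0 :> R by rewrite pnatr_eq0 -lt0n (leq_trans _ T2).
have n1 : #|T|%:R - 1 != 0 :> R by rewrite subr_eq0 pnatr_eq1; case: #|T| T2 => [|[|]].
(* For b = 1 both sides vanish; this case is separate because [b.-2] truncates. *)
have [b2|] := leqP 2 b; last first.
  case: b b0 bT => [|[|]] // _ _ _; rewrite subrr mulr0 mul0r.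
  rewrite (eq_card0 (A := [pred A in _ | _])) ?mulr0 // => A; rewrite !inE.
  apply/negP => /and3P[/cards1P[k ->]]; rewrite !inE => /eqP ik /eqP jk.
  by rewrite ik jk eqxx in ij.
have -> : #|[pred A in draws b | (i \in A) && (j \in A)]| = 'C(#|T|.-2, b.-2).
  have := @card_draws_sup [set i; j] b; rewrite cards2 ij !subn2 => <- //.
  by apply: eq_card => A; rewrite !inE subUset !sub1set andbC.
rewrite card_draws.
case: b b2 b0 bT => [|[|b]] // _ _ bT.
case: #|T| T2 n0 n1 bT => [|[|n]] // _ n0 n1 bT /=.
have := mul_bin_diag n.+2 b.+1; have := mul_bin_diag n.+1 b => /=.
move=> /(congr1 (fun k => k%:R : R)) + /(congr1 (fun k => k%:R : R)).
rewrite !natrM => E1 E2.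
have C0 : 'C(n.+2, b.+2)%:R != 0 :> R by rewrite pnatr_eq0 -lt0n bin_gt0.
have eb : b.+2%:R - 1 = b.+1%:R :> R by rewrite -[b.+2%:R]natr1 addrK.
have en : n.+2%:R - 1 = n.+1%:R :> R by rewrite -[n.+2%:R]natr1 addrK.
rewrite eb en in n1 *.
apply: (mulfI C0); rewrite mulrA divff // mul1r mulrA.
apply: (mulIf (mulf_neq0 n0 n1)); rewrite divfK ?mulf_neq0 //.
transitivity (n.+2%:R * (n.+1%:R * 'C(n, b)%:R) : R); first by ring.
rewrite E1; transitivity (b.+1%:R * (n.+2%:R * 'C(n.+1, b.+1)%:R) : R); first by ring.
by rewrite E2; ring.
Qed.

Lemma avg_draws_sum (b : nat) (f : T -> R) : (0 < b <= #|T|)%N ->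
  avg (draws b) (fun A => \sum_(i in A) f i) = b%:R / #|T|%:R * \sum_i f i.
Proof.
move=> hb; rewrite (@eq_avg _ _ _ _ (fun A : {set T} => \sum_i f i * (i \in A)%:R)).
  rewrite avg_sum mulr_sumr; apply: eq_bigr => i _.
  by rewrite avgZ avg_draws_mem // mulrC.
move=> A _; rewrite big_mkcond; apply: eq_bigr => i _.
by case: (i \in A); rewrite ?mulr1 ?mulr0.
Qed.

(** Off-diagonal pairs are drawn with probability [p2], diagonal ones with [p1]; extending weight
    [p2] to the diagonal leaves [p1 - p2] there. *)
Lemma avg_draws_sum2 (b : nat) (f : T -> T -> R) : (0 < b <= #|T|)%N ->
  let p1 := b%:R / #|T|%:R in
  let p2 := b%:R * (b%:R - 1) / (#|T|%:R * (#|T|%:R - 1)) in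
  avg (draws b) (fun A => \sum_(i in A) \sum_(j in A) f i j)
  = p2 * (\sum_i \sum_j f i j) + (p1 - p2) * \sum_i f i i.
Proof.
move=> hb p1 p2.
rewrite (@eq_avg _ _ _ _
  (fun A : {set T} => \sum_i \sum_j f i j * ((i \in A) && (j \in A))%:R)).
  rewrite avg_sum !mulr_sumr -big_split; apply: eq_bigr => i _ /=.
  rewrite avg_sum (bigD1 i) //= [in RHS](bigD1 i) //= mulrDr.
  under eq_avg do rewrite andbb.
  rewrite avgZ avg_draws_mem // -/p1 mulr_sumr.
  rewrite (eq_bigr (fun j => p2 * f i j)) => [|j ji]; first by ring.
  by rewrite avgZ avg_draws_mem2 1?eq_sym // mulrC.
move=> A _; rewrite big_mkcond; apply: eq_bigr => i _.
case: (i \in A) => /=; last by rewrite big1 // => j _; rewrite mulr0.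
rewrite big_mkcond; apply: eq_bigr => j _.
by case: (j \in A); rewrite ?mulr1 ?mulr0.
Qed.

End Draws.

(** Here m, the upper half of T, is the number of iterates that enter the average. *)
Lemma half_bounds (T : nat) (m := (T - T./2)%N) :
  [/\ T <= 2 * m, 2 * m <= T.+1, T./2 <= m, m <= T./2 + 1
      & T.+1 - (T./2 + 1) = m]%N.
Proof. by rewrite /m; split; lia. Qed.

(** * Independence of the coordinates in a finite product space *)

Section Resampling.
Variables (R : realFieldType) (K S : finType).
Implicit Types (om : {ffun K -> S}) (D : {set S}).

Definition ffun_upd om (k : K) (a : S) : {ffun K -> S} :=
  [ffun i => if i == k then a else om i].

Definition ffun_in D : {set {ffun K -> S}} :=
  [set om : {ffun K -> S} | [forall k, om k \in D]].

(* The map (om, a) |-> (om[k := a], om k) is an involution of the product space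
   that exchanges the coordinate k with an independent copy of it. *)
Lemma avg_resample D (k : K) (F : {ffun K -> S} -> R) : (0 < #|D|)%N ->
  avg (ffun_in D) F
  = avg (ffun_in D) (fun om => avg D (fun a => F (ffun_upd om k a))).
Proof.
move=> D0; rewrite [in RHS]/avg -mulr_sumr pair_big /=.
pose h (p : {ffun K -> S} * S) := (ffun_upd p.1 k p.2, p.1 k).
have hK : involutive h.
  case=> om a; rewrite /h /= ffunE eqxx; congr pair.
  by apply/ffunP => i; rewrite !ffunE; case: eqP => // ->.
rewrite (reindex_inj (inv_inj hK)) /=.
rewrite (eq_big (fun p => (p.1 \in ffun_in D) && (p.2 \in D)) (fun p => F p.1)).
- rewrite -(pair_big (mem (ffun_in D)) (mem D) (fun om _ => F om)) /=.
  rewrite /avg; congr (_ * _).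
  under [in RHS]eq_bigr => om _ do rewrite sumr_const -[F om *+ _]mulr_natl.
  by rewrite -mulr_sumr mulrA mulVf ?mul1r // pnatr_eq0 -lt0n.
- case=> om a /=; rewrite !inE.
  apply/andP/andP => -[/forallP omD aD]; split=> //.
  + apply/forallP => i; have := omD i; rewrite ffunE; case: eqP => // -> _.
    by [].
  + by have := omD k; rewrite ffunE eqxx.
  + apply/forallP => i; rewrite ffunE; case: eqP => // _; exact: omD.
- case=> om a _ /=; congr F; apply/ffunP => i; rewrite !ffunE.
  by case: eqP => // ->.
Qed.

End Resampling.

(** * Hinge subgradients and their second moments *)

Section Pegasos.
Variables (R : realType) (d n : nat) (x : 'I_n -> 'cV[R]_d) (y : 'I_n -> R).
Variables (sigma2 lam : R) (b : nat).
Hypotheses (n2 : (2 <= n)%N) (y1 : forall i, y i = 1 \/ y i = -1).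
Hypotheses (x1 : forall i, vnorm (x i) <= 1).
Hypothesis sigmaX : n%:R^-1 * specnorm (datamx x) ^+ 2 <= sigma2.
Hypotheses (lam0 : 0 < lam) (b1n : (1 <= b <= n)%N).

Local Notation P := (svmP lam x y).

Let G2 : R := (1 + (b%:R - 1) * (n%:R * sigma2 - 1) / (n%:R - 1)) / b%:R.

(** [hinge_coef v i *: x i] is minus a subgradient at v of the i-th hinge loss; at the kink it is
    0. *)
Definition hinge_coef (v : 'cV[R]_d) (i : 'I_n) : R :=
  if y i * dotv v (x i) < 1 then y i else 0.

Definition hinge_batch (A : {set 'I_n}) (v : 'cV[R]_d) : 'cV[R]_d :=
  b%:R^-1 *: \sum_(i in A) hinge_coef v i *: x i.

Definition hinge_full (v : 'cV[R]_d) : 'cV[R]_d :=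
  n%:R^-1 *: \sum_i hinge_coef v i *: x i.

Let n_gt0 : 0 < n%:R :> R. Proof. by rewrite ltr0n (leq_trans _ n2). Qed.
Let nE : n%:R = \sum_(i < n) 1 :> R.
Proof. by rewrite sumr_const card_ord. Qed.
Let n1_gt0 : 0 < n%:R - 1 :> R. Proof. by rewrite subr_gt0 ltr1n. Qed.
Let b_gt0 : 0 < b%:R :> R. Proof. by rewrite ltr0n; case/andP: b1n. Qed.
Let b1_ge0 : 0 <= b%:R - 1 :> R.
Proof. by rewrite subr_ge0 ler1n; case/andP: b1n. Qed.
Let bn : b%:R <= n%:R :> R. Proof. by rewrite ler_nat; case/andP: b1n. Qed.
Let b1I : (0 < b <= #|'I_n|)%N. Proof. by rewrite card_ord. Qed.
Let draws0 : (0 < #|draws 'I_n b|)%N.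
Proof. by apply: draws_gt0; case/andP: b1I. Qed.

(** Shows the update as a subgradient step of length 1/(lam t) on the objective restricted to the
    batch. *)
Lemma peg_stepE t A v :
  peg_step lam b x y t A v
  = v - (lam * t%:R)^-1 *: (lam *: v - hinge_batch A v).
Proof.
rewrite /peg_step /hinge_batch big_mkcondr /= scalerBl scale1r scalerBr opprB.
rewrite !scalerA -addrA [X in _ + X]addrC; congr (_ + (_ *: _ - _)).
apply: eq_bigr => i _; rewrite /hinge_coef.
by case: ifP => // _; rewrite scale0r.
Qed.

Lemma hinge_coef_sqr v i : hinge_coef v i ^+ 2 <= 1.
Proof.
rewrite /hinge_coef; case: ifP => _; last by rewrite expr0n.
by case: (y1 i) => ->; rewrite ?sqrrN expr1n.
Qed.

(** Unbiasedness: the inclusion probability b/n turns the weight 1/b into 1/n. *)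
Lemma avg_hinge_batch v z :
  avg (draws 'I_n b) (fun A => dotv (hinge_batch A v) z) = dotv (hinge_full v) z.
Proof.
rewrite (@eq_avg _ _ _ _
  (fun A : {set 'I_n} => b%:R^-1 * \sum_(i in A) dotv (hinge_coef v i *: x i) z)); last first.
  by move=> A _; rewrite dotvZl dotv_suml.
rewrite avgZ avg_draws_sum // card_ord dotvZl dotv_suml !mulrA mulVf ?mul1r //.
exact: lt0r_neq0.
Qed.

(** The sum is X c with |c|^2 <= n, and |X|^2 <= n [sigma2]. *)
Lemma sum_coef_sqr (c : 'I_n -> R) : (forall i, c i ^+ 2 <= 1) ->
  dotv (\sum_i c i *: x i) (\sum_i c i *: x i) <= n%:R ^+ 2 * sigma2.
Proof.
move=> c1; have sn : 0 < Num.sqrt n%:R :> R by rewrite sqrtr_gt0.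
have -> : \sum_i c i *: x i = datamx x *m \col_i c i.
  apply/matrixP => k j; rewrite ord1 summxE mxE; apply: eq_bigr => i _.
  by rewrite !mxE mulrC.
have cn : dotv (\col_i c i) (\col_i c i) <= Num.sqrt n%:R ^+ 2 :> R.
  rewrite sqr_sqrtr ?(ltW n_gt0) // nE /dotv.
  by apply: ler_sum => i _; rewrite !mxE -expr2.
apply: (le_trans (dotv_mulmx_le (datamx x) sn cn)).
rewrite exprMn sqr_sqrtr ?(ltW n_gt0) // [n%:R ^+ 2]expr2 mulrC -mulrA.
by rewrite ler_pM2l // -ler_pdivrMl.
Qed.

(* Sampling without replacement: a pair of distinct indices lies in A with
   probability b(b-1)/(n(n-1)), so the second moment interpolates between the
   diagonal bound 1 and the spectral bound n * sigma2. *)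
Lemma avg_hinge_batch_sqr v :
  avg (draws 'I_n b) (fun A => dotv (hinge_batch A v) (hinge_batch A v)) <= G2.
Proof.
pose f i j := dotv (hinge_coef v i *: x i) (hinge_coef v j *: x j).
rewrite (@eq_avg _ _ _ _
  (fun A : {set 'I_n} => b%:R^-1 ^+ 2 * \sum_(i in A) \sum_(j in A) f i j)); last first.
  by move=> A _; rewrite !dotvE dotv_sum_sqr mulrA expr2.
rewrite avgZ avg_draws_sum2 // card_ord.
have -> : \sum_i \sum_j f i j
    = dotv (\sum_i hinge_coef v i *: x i) (\sum_i hinge_coef v i *: x i).
  by rewrite dotv_sum_sqr.
set q := dotv _ _; have hq : q <= n%:R ^+ 2 * sigma2.
  exact: sum_coef_sqr (hinge_coef_sqr v).
set r := \sum_i _; have hr : r <= n%:R.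
  rewrite nE; apply: ler_sum => i _.
  rewrite /f !dotvE mulrA -expr2.
  have := x1 i; rewrite vnorm_le // expr1n => xi.
  by rewrite mulr_ile1 ?sqr_ge0 ?dotv_ge0 ?hinge_coef_sqr.
set p2 : R := b%:R * (b%:R - 1) / _; set p1 : R := b%:R / n%:R.
have p20 : 0 <= p2.
  by rewrite divr_ge0 ?mulr_ge0 ?ler0n ?(ltW n1_gt0).
(* Both weights are nonnegative, since b <= n, so the bounds on [q] and [r] may be substituted; the
   result is exactly [G2]. *)
have p12 : 0 <= p1 - p2.
  have -> : p1 - p2 = b%:R * (n%:R - b%:R) / (n%:R * (n%:R - 1)).
    by rewrite /p1 /p2; field; rewrite !lt0r_neq0.
  by rewrite divr_ge0 ?mulr_ge0 ?ler0n ?(ltW n1_gt0) ?subr_ge0.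
have -> : G2 = b%:R^-1 ^+ 2 * (p2 * (n%:R ^+ 2 * sigma2) + (p1 - p2) * n%:R).
  by rewrite /G2 /p1 /p2; field; rewrite !lt0r_neq0.
by rewrite ler_wpM2l ?exprn_ge0 ?invr_ge0 ?ler0n // lerD // ler_wpM2l.
Qed.

(** Second moment minus squared mean is a variance, hence nonnegative. In particular [G2] is
    nonnegative. *)
Lemma hinge_full_sqr v : dotv (hinge_full v) (hinge_full v) <= G2.
Proof.
apply: le_trans (avg_hinge_batch_sqr v); rewrite -subr_ge0.
set h := hinge_full v.
suff -> : avg (draws 'I_n b) (fun A => dotv (hinge_batch A v) (hinge_batch A v))
    - dotv h h
  = avg (draws 'I_n b) (fun A => dotv (hinge_batch A v - h) (hinge_batch A v - h)).
  apply: le_trans (le_avg (f := fun=> 0) _); first by rewrite avg_cst.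
  by move=> A _; exact: dotv_ge0.
rewrite [RHS](@eq_avg _ _ _ _ (fun A => dotv (hinge_batch A v) (hinge_batch A v)
    + (-2 * dotv (hinge_batch A v) h + dotv h h))); last first.
  by move=> A _; exact: dotvB_sqr.
by rewrite !avgD avgZ avg_hinge_batch avg_cst // -/h; ring.
Qed.

Let G2_ge0 : 0 <= G2. Proof. exact: le_trans (dotv_ge0 _) (hinge_full_sqr 0). Qed.

(** * Strong convexity and quadratic growth of the objective *)

Lemma svmP_subgrad v w :
  P v + dotv (lam *: v - hinge_full v) (w - v) + lam / 2 * dotv (w - v) (w - v)
  <= P w.
Proof.
rewrite /svmP !sqr_vnorm.
(* Only the hinge part needs an inequality, checked example by example; the regularizer expands
   exactly and supplies the quadratic term. *)
have H : n%:R^-1 * (\sum_i Num.max 0 (1 - y i * dotv v (x i)))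
    - dotv (hinge_full v) (w - v)
  <= n%:R^-1 * \sum_i Num.max 0 (1 - y i * dotv w (x i)).
  rewrite dotvZl dotv_suml -mulrBr -sumrB ler_wpM2l ?invr_ge0 ?ler0n //.
  apply: ler_sum => i _; rewrite /hinge_coef dotvZl dotvDr dotvNr !(dotvC (x i)).
  case: ltP => c; case: (leP 0 (1 - y i * dotv w (x i))) => cw;
    case: (leP 0 (1 - y i * dotv v (x i))) => cv; lra.
move: H; move: (hinge_full v) => h.
by rewrite !dotvE [dotv w v]dotvC; lra.
Qed.

Lemma svmP_ge0 v : 0 <= P v.
Proof.
apply: addr_ge0; apply: mulr_ge0; rewrite ?sqr_ge0 ?invr_ge0 ?ler0n //.
  by apply: sumr_ge0 => i _; rewrite le_max lexx.
by rewrite divr_ge0 ?(ltW lam0).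
Qed.

Lemma has_lbound_svmP : has_lbound (range P).
Proof. by exists 0 => _ [v _ <-]; exact: svmP_ge0. Qed.

(** At the midpoint z of u and w the linear terms of the two subgradient inequalities cancel, so P u
    + P w >= 2 P z + lam/4 |u - w|^2, and P z is at least the infimum. *)
Lemma svmP_growth u w :
  lam / 4 * dotv (u - w) (u - w) - 2 * (P w - inf (range P)) <= P u - P w.
Proof.
pose z := 2^-1 *: (u + w).
have zi : inf (range P) <= P z by apply: ge_inf; [exact: has_lbound_svmP | exists z].
have := svmP_subgrad z u; have := svmP_subgrad z w.
have -> : u - z = 2^-1 *: (u - w).
  by apply/matrixP => i j; rewrite !mxE; field.
have -> : w - z = - (2^-1 *: (u - w)).
  by apply/matrixP => i j; rewrite !mxE; field.
rewrite !dotvNr !dotvNl opprK !dotvZr !dotvZl; set e := dotv _ (u - w); set g := dotv _ _.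
lra.
Qed.

(** * Jensen's inequality for means, and rescaling of the average *)

Lemma sum_sub_mean (I : Type) (r : seq I) (w : I -> 'cV[R]_d) (k : R) :
  k != 0 -> k = (size r)%:R ->
  \sum_(i <- r) (w i - k^-1 *: \sum_(j <- r) w j) = 0.
Proof.
move=> k0 kE; rewrite sumrB big_const_seq count_predT iter_addr_0 -scaler_nat.
by rewrite -kE scalerA divff // scale1r subrr.
Qed.

(** Sums the subgradient inequality at the mean; the linear terms add up to zero. *)
Lemma svmP_jensen (r : seq nat) (w : nat -> 'cV[R]_d) (k : R) :
  k != 0 -> k = (size r)%:R ->
  k * P (k^-1 *: \sum_(j <- r) w j) <= \sum_(i <- r) P (w i).
Proof.
move=> k0 kE; set u := _ *: _.
apply: (@le_trans _ _ (\sum_(i <- r) (P u + dotv (w i - u) (lam *: u - hinge_full u)))).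
  rewrite big_split /= -dotv_suml sum_sub_mean // dotv0l addr0 big_const_seq.
  by rewrite count_predT iter_addr_0 -[_ *+ _]mulr_natl -kE.
apply: ler_sum => i _; apply: le_trans (svmP_subgrad u (w i)).
by rewrite dotvC lerDl mulr_ge0 ?dotv_ge0 // divr_ge0 ?(ltW lam0).
Qed.

Lemma dotv_jensen (r : seq nat) (w : nat -> 'cV[R]_d) (k : R) :
  k != 0 -> k = (size r)%:R ->
  let u := k^-1 *: \sum_(j <- r) w j in
  k * dotv u u <= \sum_(i <- r) dotv (w i) (w i).
Proof.
move=> k0 kE; set u := _ *: _ => /=.
apply: (@le_trans _ _ (\sum_(i <- r) (dotv u u + 2 * dotv (w i - u) u))).
  rewrite big_split /= -mulr_sumr -(dotv_suml _ _ (fun i => w i - u)).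
  rewrite sum_sub_mean // dotv0l mulr0 addr0.
  by rewrite big_const_seq count_predT iter_addr_0 -[_ *+ _]mulr_natl -kE.
apply: ler_sum => i _; have := dotv_ge0 (w i - u).
by rewrite dotvB_sqr dotvDl dotvNl; lra.
Qed.

(* Accounts for odd T, where the weights of the average sum to 1 + 1/T. *)
Lemma svmP_rescale u (rho : R) : 0 <= rho <= 1 ->
  P ((1 + rho) *: u)
  <= P u + rho * (5 / 2 * lam * dotv u u + G2 / (2 * lam)).
Proof.
have l0 := lam0; move=> /andP[r0 r1]; set v := _ *: u.
have := svmP_subgrad v u.
have -> : u - v = - rho *: u by rewrite /v scalerDl scale1r opprD addNKr scaleNr.
have := hinge_full_sqr v; move: (hinge_full v) => h hh.
have uu := dotv_ge0 u.
(* Young's inequality, from |lam u + h|^2 >= 0. *)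
have hu : - dotv h u <= lam / 2 * dotv u u + G2 / (2 * lam).
  have := dotv_ge0 (lam *: u + h); rewrite !dotvE [dotv u h]dotvC => hl.
  have -> : lam / 2 * dotv u u + G2 / (2 * lam)
    = (lam ^+ 2 * dotv u u + G2) / (2 * lam) by field; rewrite lt0r_neq0.
  rewrite ler_pdivlMr; last lra.
  by move: hl hh; set a := dotv u u; set c := dotv h u; lra.
rewrite !dotvE => H.
have {}H : P v <= P u + rho * (lam * (1 + rho) * dotv u u - dotv h u)
  - lam / 2 * (rho ^+ 2 * dotv u u) by move: H; lra.
apply: (le_trans H).
(* 5/2 = 2 + 1/2: the 2 bounds 1 + rho, the 1/2 comes from [hu]. *)
have : rho * (lam * (1 + rho) * dotv u u - dotv h u)
   <= rho * (5 / 2 * lam * dotv u u + G2 / (2 * lam)).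
  apply: ler_wpM2l => //.
  have : lam * (1 + rho) * dotv u u <= 2 * lam * dotv u u.
    by rewrite ler_wpM2r // mulrC ler_wpM2r; lra.
  by lra.
have : 0 <= lam / 2 * (rho ^+ 2 * dotv u u).
  by rewrite !mulr_ge0 ?sqr_ge0 ?invr_ge0 // ltW.
by lra.
Qed.

(** * The random iterates: conditioning on the past and norm bound *)

Section Iterates.
Variable T : nat.

Local Notation E := (avg (batches n b T)).

Let W (om : {ffun 'I_T -> {set 'I_n}}) (t : nat) := w_iter lam b x y (sched om) t.

Lemma batchesE : batches n b T = ffun_in 'I_T (draws 'I_n b).
Proof. by apply/setP => om; rewrite !inE; apply: eq_forallb => k; rewrite inE. Qed.

Let batches0 : (0 < #|batches n b T|)%N.
Proof.
have [A Ab] : exists A : {set 'I_n}, A \in draws 'I_n b by apply/card_gt0P.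
apply/card_gt0P; exists [ffun=> A]; rewrite batchesE inE.
by apply/forallP => k; rewrite ffunE.
Qed.

Lemma w_iterS (A : nat -> {set 'I_n}) t : (0 < t)%N ->
  w_iter lam b x y A t.+1 = peg_step lam b x y t (A t) (w_iter lam b x y A t).
Proof. by case: t. Qed.

(** Adaptedness of the iterates, which makes w^(t) independent of A_t. *)
Lemma eq_w_iter (A A' : nat -> {set 'I_n}) t :
  (forall s, (0 < s < t)%N -> A s = A' s) ->
  w_iter lam b x y A t = w_iter lam b x y A' t.
Proof.
elim: t => [_ //|[_ _ //|t] IH AA'].
rewrite (w_iterS A (ltn0Sn t)) (w_iterS A' (ltn0Sn t)).
have -> : A t.+1 = A' t.+1 by apply: AA'; rewrite ltn0Sn ltnSn.
congr (peg_step _ _ _ _ _ _ _).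
by apply: IH => s /andP[s0 st]; apply: AA'; rewrite s0 ltnS ltnW.
Qed.

(** Coordinate k holds batch k + 1. Time 0 is excluded because [sched] reads [s.-1], which would
    identify it with time 1. *)
Lemma sched_upd (om : {ffun 'I_T -> {set 'I_n}}) (k : 'I_T) (A : {set 'I_n}) s :
  (0 < s)%N ->
  sched (ffun_upd om k A) s = if s == k.+1 then A else sched om s.
Proof.
case: s => // s _; rewrite /sched /= eqSS; case: insubP => [i _ <-|] /=.
  by rewrite ffunE.
by rewrite -leqNgt; case: eqP => // ->; rewrite leqNgt ltn_ord.
Qed.

(** Conditioning on the past: resampling the coordinate of A_t leaves w^(t) unchanged. *)
Lemma avg_w_step (t : nat) (F : 'cV[R]_d -> R) : (0 < t <= T)%N ->
  E (fun om => F (W om t.+1))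
  = E (fun om => avg (draws 'I_n b) (fun A => F (peg_step lam b x y t A (W om t)))).
Proof.
case: t => [//|t] tT; pose k : 'I_T := Ordinal (andP tT).2.
rewrite batchesE (avg_resample k _ draws0); apply: eq_avg => om _.
apply: eq_avg => A _; rewrite /W (w_iterS _ (ltn0Sn t)).
rewrite (sched_upd om k A (ltn0Sn t)) eqxx.
congr (F (peg_step _ _ _ _ _ _ _)); apply: eq_w_iter => s /andP[s0 st].
by rewrite sched_upd // ifN // neq_ltn st.
Qed.

Lemma W1 om : W om 1 = 0. Proof. by []. Qed.

Lemma avg_W_sqr t : (0 < t <= T)%N ->
  E (fun om => dotv (W om t) (W om t)) <= G2 / lam ^+ 2.
Proof.
have Gl : 0 <= G2 / lam ^+ 2 by rewrite divr_ge0 ?sqr_ge0.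
elim: t => // -[|t] IH tT.
  by rewrite (@eq_avg _ _ _ _ (fun=> 0)) ?avg_cst // => om _; rewrite W1 dotv0l.
have {}tT : (0 < t.+1 <= T)%N by rewrite /= ltnW.
have {}IH := IH tT.
rewrite (avg_w_step (fun w => dotv w w)) //.
set th : R := t.+1%:R^-1.
have th0 : 0 <= th by rewrite invr_ge0.
have th1 : th <= 1 by rewrite invf_le1 ?ltr0n // ler1n.
have l0 := lam0.
apply: (@le_trans _ _ (E (fun om =>
    (1 - th) * dotv (W om t.+1) (W om t.+1) + th * (G2 / lam ^+ 2)))).
  apply: le_avg => om _; move: (W om t.+1) => v.
  apply: (@le_trans _ _ (avg (draws 'I_n b) (fun A => (1 - th) * dotv v v
      + (th / lam ^+ 2) * dotv (hinge_batch A v) (hinge_batch A v)))).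
    apply: le_avg => A _; rewrite peg_stepE; move: (hinge_batch A v) => h.
    have -> : v - (lam * t.+1%:R)^-1 *: (lam *: v - h)
        = (1 - th) *: v + (th / lam) *: h.
      rewrite invfM -/th; apply/matrixP => i j; rewrite !mxE; field.
      by rewrite lt0r_neq0.
    (* The new iterate is a convex combination of v and h / lam; this coefficient times |lam v -
       h|^2 is the exact gap in convexity of the squared norm. *)
    have th2 : 0 <= th * (1 - th) / lam ^+ 2.
      by rewrite divr_ge0 ?sqr_ge0 // mulr_ge0 // subr_ge0.
    rewrite -subr_ge0; apply: le_trans (mulr_ge0 th2 (dotv_ge0 (lam *: v - h))) _.
    rewrite !dotvE [dotv h v]dotvC le_eqVlt; apply/orP; left; apply/eqP.
    by field; rewrite lt0r_neq0.
  rewrite avgD avg_cst // lerD2l avgZ -mulrA ler_wpM2l // mulrC.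
  rewrite ler_wpM2r ?invr_ge0 ?sqr_ge0 //.
  exact: avg_hinge_batch_sqr.
rewrite avgD avg_cst // avgZ.
have : (1 - th) * E (fun om => dotv (W om t.+1) (W om t.+1)) <= (1 - th) * (G2 / lam ^+ 2).
  by rewrite ler_wpM2l // subr_ge0.
by lra.
Qed.

(** * Distance recursion relative to a fixed comparator *)

Section Comparator.
Variable w : 'cV[R]_d.

Let a t := E (fun om => dotv (W om t - w) (W om t - w)).
Let gap t := E (fun om => P (W om t)) - P w.
Let delta := P w - inf (range P).

Let a_ge0 t : 0 <= a t.
Proof.
by rewrite -[0](@avg_cst _ _ (batches n b T)) //; apply: le_avg => om _; exact: dotv_ge0.
Qed.

Let delta_ge0 : 0 <= delta.
Proof. by rewrite subr_ge0; apply: ge_inf; [exact: has_lbound_svmP | exists w]. Qed.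

Lemma peg_step_dist t v : (0 < t)%N ->
  avg (draws 'I_n b) (fun A =>
    dotv (peg_step lam b x y t A v - w) (peg_step lam b x y t A v - w))
  <= (1 - t%:R^-1) * dotv (v - w) (v - w) - 2 / (lam * t%:R) * (P v - P w)
     + 2 / (t%:R ^+ 2) * dotv v v + 2 / (lam * t%:R) ^+ 2 * G2.
Proof.
move=> t0; set eta := (lam * t%:R)^-1; have l0 := lam0.
have t0R : 0 < t%:R :> R by rewrite ltr0n.
have eta0 : 0 <= eta by rewrite invr_ge0 mulr_ge0 // ltW.
apply: (@le_trans _ _ (avg (draws 'I_n b) (fun A =>
   (dotv (v - w) (v - w) - 2 * eta * lam * dotv v (v - w) + 2 * eta ^+ 2 * lam ^+ 2 * dotv v v)
   + (2 * eta * dotv (hinge_batch A v) (v - w)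
      + 2 * eta ^+ 2 * dotv (hinge_batch A v) (hinge_batch A v))))).
  apply: le_avg => A _; rewrite peg_stepE; move: (hinge_batch A v) => h.
  rewrite -/eta; move: eta eta0 => e e0.
  (* Parallelogram bound |lam v - h|^2 <= 2 lam^2 |v|^2 + 2 |h|^2. *)
  have := mulr_ge0 (sqr_ge0 e) (dotv_ge0 (lam *: v + h)).
  rewrite !dotvE [dotv h v]dotvC [dotv w v]dotvC [dotv w h]dotvC => H.
  by rewrite -subr_ge0; apply: (le_trans H); rewrite le_eqVlt; apply/orP; left; apply/eqP; ring.
rewrite avgD avg_cst // avgD !avgZ avg_hinge_batch.
have H1 := svmP_subgrad v w; have H2 := avg_hinge_batch_sqr v.
have {}H2 : 2 * eta ^+ 2 * avg (draws 'I_n b) (fun A =>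
      dotv (hinge_batch A v) (hinge_batch A v))
   <= 2 * eta ^+ 2 * G2 by rewrite ler_wpM2l // mulr_ge0 ?sqr_ge0.
have {}H1 := mulr_ge0 (mulr_ge0 (ler0n R 2) eta0) (etrans (subr_ge0 _ _) H1).
have -> : 2 / (lam * t%:R) ^+ 2 = 2 * eta ^+ 2 by rewrite /eta exprVn.
have -> : t%:R^-1 = eta * lam by rewrite /eta; field; rewrite !lt0r_neq0.
have -> : 2 / t%:R ^+ 2 = 2 * eta ^+ 2 * lam ^+ 2.
  by rewrite /eta; field; rewrite !lt0r_neq0.
apply: le_trans (lerD (lexx _) (lerD (lexx _) H2)) _; rewrite -subr_ge0.
move: H1; move: (hinge_full v) eta {H2 eta0} => h e.
rewrite -(opprB v w) !dotvE [dotv w v]dotvC => H.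
by apply: (le_trans H); rewrite le_eqVlt; apply/orP; left; apply/eqP; field.
Qed.

(** Averages [peg_step_dist], whose two noise terms each contribute at most 2 G2 / (lam t)^2.
    Scaling by lam t / 2 turns the factor 1 - 1/t into a telescoping t - 1. *)
Lemma gap_le t : (0 < t <= T)%N ->
  gap t <= lam / 2 * (t.-1%:R * a t - t%:R * a t.+1) + 2 * G2 / (lam * t%:R).
Proof.
move=> tT; have t0 : (0 < t)%N by case/andP: tT.
have l0 := lam0; have t0R : 0 < t%:R :> R by rewrite ltr0n.
have H : a t.+1 <= (1 - t%:R^-1) * a t - 2 / (lam * t%:R) * gap t
     + 4 / (lam * t%:R) ^+ 2 * G2.
  rewrite /a (avg_w_step (fun v => dotv (v - w) (v - w))) //.
  apply: (le_trans (le_avg (fun om _ => peg_step_dist (W om t) t0))).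
  rewrite avgD avg_cst // avgD avgB !avgZ avgB avg_cst // -/(a t) -/(gap t).
  have := avg_W_sqr tT => /(ler_wpM2l (_ : 0 <= 2 / t%:R ^+ 2)) H.
  have {}H := H (divr_ge0 (ler0n _ _) (sqr_ge0 _)).
  have E2 : 2 / t%:R ^+ 2 * (G2 / lam ^+ 2) = 2 / (lam * t%:R) ^+ 2 * G2.
    by field; rewrite !lt0r_neq0.
  by rewrite E2 in H; lra.
have lt0 : 0 < lam * t%:R / 2 by rewrite divr_gt0 ?mulr_gt0.
have {}H := ler_wpM2l (ltW lt0) H.
have -> : t.-1%:R = t%:R - 1 :> R by rewrite -{2}(prednK t0) -natr1 addrK.
have E1 : lam * t%:R / 2 * ((1 - t%:R^-1) * a t - 2 / (lam * t%:R) * gap t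
     + 4 / (lam * t%:R) ^+ 2 * G2)
  = lam / 2 * ((t%:R - 1) * a t) - gap t + 2 * G2 / (lam * t%:R).
  by field; rewrite !lt0r_neq0.
by rewrite E1 in H; lra.
Qed.

Lemma gap_ge t : lam / 4 * a t - 2 * delta <= gap t.
Proof.
have -> : lam / 4 * a t - 2 * delta
    = E (fun om => lam / 4 * dotv (W om t - w) (W om t - w) - 2 * delta).
  by rewrite avgB avgZ avg_cst.
have -> : gap t = E (fun om => P (W om t) - P w) by rewrite avgB avg_cst.
by apply: le_avg => om _; exact: svmP_growth.
Qed.

(* The quadratic growth of P around its infimum saves a logarithmic factor
   over the bound that gap_le gives by telescoping alone. *)
Lemma dist_le k : (k <= T)%N ->
  k%:R * a k.+1 <= 8 * G2 / lam ^+ 2 + k%:R * (4 * delta / lam).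
Proof.
have l0 := lam0; have d0 := delta_ge0.
have K0 : 0 <= 8 * G2 / lam ^+ 2 by exact: divr_ge0 (mulr_ge0 (ler0n _ 8) G2_ge0) (sqr_ge0 _).
have D0 : 0 <= 4 * delta / lam by exact: divr_ge0 (mulr_ge0 (ler0n _ 4) d0) (ltW l0).
elim: k => [|k IH] kT; first by rewrite !mul0r addr0.
have {}IH := IH (ltnW kT).
have := gap_le (t := k.+1) kT; have := gap_ge k.+1.
rewrite succnK => g1 g2.
have {g1 g2} := le_trans g1 g2.
have k1 : k.+1%:R != 0 :> R by rewrite pnatr_eq0.
set D := 4 * delta / lam in D0 IH *; set K := 8 * G2 / lam ^+ 2 in K0 IH *.
have -> : delta = D * lam / 4 by rewrite /D; field; rewrite lt0r_neq0.
have -> : 2 * G2 / (lam * k.+1%:R) = lam * K / (4 * k.+1%:R).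
  rewrite /K; move: (k.+1%:R) k1 => c c0; field.
  by rewrite c0 lt0r_neq0.
set r := lam * K / _.
have a0 := a_ge0 k.+1; have a20 := a_ge0 k.+2.
have rE : r = lam * (K / (4 * k.+1%:R)) by rewrite /r mulrA.
rewrite rE => H.
have {H r rE} H : k.+1%:R * a k.+2 <= k%:R * a k.+1 - a k.+1 / 2 + D + K / (2 * k.+1%:R).
  rewrite -(ler_pM2l (_ : 0 < lam / 2)) ?divr_gt0 //.
  have -> : K / (2 * k.+1%:R) = 2 * (K / (4 * k.+1%:R)).
    by move: (k.+1%:R) k1 => c c0; field.
  by move: H; set z := K / _; lra.
apply: (le_trans H); rewrite -[k.+1%:R in leRHS]natr1.
(* At k = 0 the noise is K/2, which the constant K covers directly. *)
case: k IH {kT H a20 k1} a0 => [|k] IH a0.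
  have : K / (2 * 1%:R) <= K by rewrite mulr1; lra.
  by lra.
(* The factor 1 - 1/(2(k+1)) in front of z releases K/(2(k+1)), which absorbs
   the noise term. *)
set z := k.+1%:R * a k.+2 in IH *.
have k0 : 0 < k.+1%:R :> R by rewrite ltr0n.
have aE : a k.+2 = z / k.+1%:R by rewrite /z mulrC mulKf // lt0r_neq0.
have kk : K / (2 * k.+2%:R) <= K / (2 * k.+1%:R).
  by rewrite ler_wpM2l // lef_pV2 ?posrE ?mulr_gt0 ?ltr0n // ler_wpM2l // ler_nat.
have q0 : 0 <= 1 - k.+1%:R^-1 / 2 :> R.
  have : k.+1%:R^-1 <= 1 :> R by rewrite invf_le1 // ler1n.
  by move: (k.+1%:R^-1) => q; lra.
have := ler_wpM2l q0 IH.
have -> : (1 - k.+1%:R^-1 / 2) * z = z - a k.+2 / 2 by rewrite aE; ring.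
have -> : (1 - k.+1%:R^-1 / 2) * (K + k.+1%:R * D)
  = K + k.+1%:R * D - K / (2 * k.+1%:R) - D / 2.
  by move: (k.+1%:R) k0 => c c0; field; rewrite lt0r_neq0.
by move: (K / _) kk => z1; move: (K / _) => z2; lra.
Qed.

(** * Averaging over the second half of the run *)

Hypothesis T_gt0 : (0 < T)%N.

Let m := (T - T./2)%N.

(** Telescoping [gap_le] leaves the distance at the start of the window, bounded by [dist_le]; the
    final distance enters with a negative sign and is dropped. Each noise term is at most the first
    one. *)
Lemma sum_gap_le :
  \sum_(T./2 + 1 <= t < T.+1) gap t
  <= 4 * G2 / lam + T./2%:R * (2 * delta) + m%:R * (2 * G2 / (lam * (T./2 + 1)%:R)).
Proof.
have l0 := lam0; set s := (T./2 + 1)%N.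
have s0 : (0 < s)%N by rewrite /s addn1.
pose f t := - (lam / 2 * (t.-1%:R * a t)).
apply: (@le_trans _ _ (\sum_(s <= t < T.+1) (f t.+1 - f t + 2 * G2 / (lam * s%:R)))).
  apply: ler_sum_nat => t /andP[st tT].
  have t0 : (0 < t)%N by exact: leq_trans st.
  apply: (le_trans (gap_le (t := t) _)); first by rewrite t0 -ltnS.
  rewrite /f succnK; apply: lerD; first by lra.
  apply: ler_wpM2l; first exact: mulr_ge0 (ler0n _ 2) G2_ge0.
  rewrite lef_pV2 ?posrE ?mulr_gt0 ?ltr0n //.
  by rewrite ler_wpM2l ?(ltW l0) // ler_nat.
have hT : (T./2 <= T)%N by rewrite -{2}(half_double T) half_leq // -addnn leq_addr.
have sT : (s <= T.+1)%N by rewrite /s addn1.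
rewrite big_split /= telescope_sumr // sumr_const_nat.
have -> : (T.+1 - s)%N = m by case: (half_bounds T).
rewrite -[_ *+ m]mulr_natl lerD2r /f succnK.
have -> : s.-1 = T./2 by rewrite /s addn1.
have -> : s = T./2.+1 by rewrite /s addn1.
have : 0 <= lam / 2 * (T%:R * a T.+1).
  by rewrite mulr_ge0 ?divr_ge0 ?(ltW l0) // mulr_ge0 ?a_ge0 ?ler0n.
have := ler_wpM2l (_ : 0 <= lam / 2) (dist_le hT) => /(_ (divr_ge0 (ltW l0) (ler0n _ 2))).
have -> : lam / 2 * (8 * G2 / lam ^+ 2 + T./2%:R * (4 * delta / lam))
   = 4 * G2 / lam + T./2%:R * (2 * delta) by field; rewrite lt0r_neq0.
by lra.
Qed.

Lemma exp_obj_sub_le :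
  exp_obj lam b x y T - P w <= 15 * G2 / (lam * T%:R) + 2 * delta.
Proof.
have l0 := lam0; have d0 := delta_ge0; have g0 := G2_ge0.
have T0 : 0 < T%:R :> R by rewrite ltr0n.
have [Tm mT hm ms rE] := half_bounds T; rewrite -/m in Tm mT hm ms rE.
have {}Tm : T%:R <= 2 * m%:R :> R by rewrite -natrM ler_nat.
have {}mT : 2 * m%:R <= T%:R + 1 :> R by rewrite -natrM natr1 ler_nat.
have {}hm : T./2%:R <= m%:R :> R by rewrite ler_nat.
have {}ms : m%:R <= (T./2 + 1)%:R :> R by rewrite ler_nat.
have m0 : 0 < m%:R :> R by lra.
(* Excess of the total weight over 1: 0 for even T, 1/T for odd T. So [wbar] is 1 + rho times the
   true mean [u]. *)
pose rho : R := 2 / T%:R * m%:R - 1.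
have rhoT : rho * T%:R <= 1.
  have -> : rho * T%:R = 2 * m%:R - T%:R by rewrite /rho; field; rewrite lt0r_neq0.
  by lra.
have rho0 : 0 <= rho.
  rewrite subr_ge0 mulrAC ler_pdivlMr // mul1r; exact: Tm.
have rhoV : rho <= T%:R^-1 by rewrite -[leRHS]mul1r ler_pdivlMr.
have rho1 : rho <= 1.
  by apply: (le_trans rhoV); rewrite invf_le1 // ler1n.
set r := index_iota (T./2 + 1) T.+1.
have mE : m%:R = (size r)%:R :> R by rewrite size_iota rE.
have m_neq0 : m%:R != 0 :> R by rewrite lt0r_neq0.
pose u om := m%:R^-1 *: \sum_(t <- r) W om t.
have uE om : wbar lam b x y om = (1 + rho) *: u om.
  by rewrite /wbar /u scalerA /rho [1 + _]addrC subrK mulfK.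
have rT t : t \in r -> (0 < t <= T)%N.
  by rewrite mem_index_iota addn1 ltnS => /andP[/(leq_trans (ltn0Sn _)) -> ->].
have Eu : E (fun om => dotv (u om) (u om)) <= G2 / lam ^+ 2.
  rewrite -(ler_pM2l m0) -avgZ.
  apply: (@le_trans _ _ (E (fun om => \sum_(t <- r) dotv (W om t) (W om t)))).
    by apply: le_avg => om _; apply: dotv_jensen.
  rewrite avg_sum mE mulr_natl -(count_predT r) -iter_addr_0 -big_const_seq.
  by rewrite !big_seq; apply: ler_sum => t /rT; exact: avg_W_sqr.
have EP : E (fun om => P (u om)) - P w <= m%:R^-1 * \sum_(t <- r) gap t.
  rewrite ler_pdivlMl // mulrBr -avgZ /gap sumrB big_const_seq iter_addr_0.
  rewrite count_predT -[P w *+ _]mulr_natl -mE lerD2r -avg_sum.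
  by apply: le_avg => om _; apply: svmP_jensen.
have Ew : exp_obj lam b x y T <= E (fun om => P (u om))
    + rho * (5 / 2 * lam * E (fun om => dotv (u om) (u om)) + G2 / (2 * lam)).
  rewrite -avgZ -[G2 / _](@avg_cst _ _ (batches n b T)) // -avgD -avgZ -avgD.
  by apply: le_avg => om _; rewrite uE; apply: svmP_rescale; rewrite rho0.
have H1 : rho * (5 / 2 * lam * E (fun om => dotv (u om) (u om)) + G2 / (2 * lam))
    <= 3 * G2 / (lam * T%:R).
  apply: (@le_trans _ _ (rho * (3 * G2 / lam))).
    apply: ler_wpM2l => //.
    have := ler_wpM2l (_ : 0 <= 5 / 2 * lam) Eu => /(_ (mulr_ge0 _ (ltW l0))) H.
    have -> : 3 * G2 / lam = 5 / 2 * lam * (G2 / lam ^+ 2) + G2 / (2 * lam).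
      by field; rewrite lt0r_neq0.
    by rewrite lerD2r; apply: H; lra.
  have -> : 3 * G2 / (lam * T%:R) = T%:R^-1 * (3 * G2 / lam).
    by field; rewrite !lt0r_neq0.
  by rewrite ler_wpM2r // divr_ge0 ?(ltW l0) // mulr_ge0.
(* 12 = 8 + 4: after division by m >= T/2, the starting distance costs 8 and the noise 4, in units
   of G2 / (lam T). *)
have H2 : m%:R^-1 * \sum_(t <- r) gap t <= 12 * G2 / (lam * T%:R) + 2 * delta.
  rewrite ler_pdivrMl //; apply: (le_trans sum_gap_le).
  set c := 2 * G2 / (lam * T%:R).
  have c0 : 0 <= c by exact: divr_ge0 (mulr_ge0 (ler0n _ 2) g0) (mulr_ge0 (ltW l0) (ltW T0)).
  have h1 : 4 * G2 / lam <= m%:R * (4 * c).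
    have -> : 4 * G2 / lam = T%:R * (2 * c) by rewrite /c; field; rewrite !lt0r_neq0.
    have : T%:R * (2 * c) <= 2 * m%:R * (2 * c) by rewrite ler_wpM2r // mulr_ge0.
    by lra.
  have h2 : 2 * G2 / (lam * (T./2 + 1)%:R) <= 2 * c.
    have -> : 2 * c = 2 * G2 / (lam * (T%:R / 2)).
      by rewrite /c; field; rewrite !lt0r_neq0.
    apply: ler_wpM2l; first exact: mulr_ge0 (ler0n _ 2) g0.
    have hs : T%:R / 2 <= (T./2 + 1)%:R :> R by lra.
    have Th : 0 < T%:R / 2 :> R by rewrite divr_gt0.
    rewrite lef_pV2 ?posrE; [|exact: mulr_gt0 (lt_le_trans Th hs)|exact: mulr_gt0].
    by rewrite ler_wpM2l ?(ltW l0).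
  have h3 : T./2%:R * (2 * delta) <= m%:R * (2 * delta) by rewrite ler_wpM2r // mulr_ge0.
  have -> : 12 * G2 / (lam * T%:R) = 6 * c by rewrite /c; field; rewrite !lt0r_neq0.
  have := ler_wpM2l (ltW m0) h2; lra.
have -> : 15 * G2 / (lam * T%:R) = 12 * G2 / (lam * T%:R) + 3 * G2 / (lam * T%:R).
  by field; rewrite !lt0r_neq0.
by lra.
Qed.

End Comparator.
End Iterates.
End Pegasos.

(** * Passing to the infimum of the objective *)

Theorem theorem1 (R : realType) (d n : nat) (x : 'I_n -> 'cV[R]_d)
  (y : 'I_n -> R) (sigma2 lam : R) (b T : nat) :
  (2 <= n)%N ->
  (forall i, y i = 1 \/ y i = -1) ->
  (forall i, vnorm (x i) <= 1) ->
  n%:R^-1 * specnorm (datamx x) ^+ 2 <= sigma2 ->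
  0 < lam ->
  (1 <= b <= n)%N ->
  (1 <= T)%N ->
  let beta := 1 + (b%:R - 1) * (n%:R * sigma2 - 1) / (n%:R - 1) in
  exp_obj lam b x y T - inf (range (svmP lam x y))
    <= beta / b%:R * (30 / (lam * T%:R)).
Proof.
move=> n2 y1 x1 sX lam0 b1n T0 /=; set beta := 1 + _.
have bnd := exp_obj_sub_le n2 y1 x1 sX lam0 b1n _ T0.
have G0 : 0 <= beta / b%:R.
  exact: le_trans (dotv_ge0 _) (hinge_full_sqr n2 y1 x1 sX b1n 0).
have [l0 t0] : 0 < lam /\ 0 < T%:R :> R by rewrite lam0 ltr0n.
apply/ler_addgt0Pr => e e0.
have hi : has_inf (range (svmP lam x y)).
  by split; [exists (svmP lam x y 0), 0 | exact: has_lbound_svmP].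
(* Replacing P w by the infimum costs delta on top of the 2 delta in [bnd], hence a comparator
   within e/3. *)
have e3 : 0 < e / 3 by lra.
have [_ [w _ <-] we] := inf_adherent e3 hi.
have := bnd w; rewrite -/beta.
have -> : beta / b%:R * (30 / (lam * T%:R)) = 30 * (beta / b%:R) / (lam * T%:R) by ring.
have : 15 * (beta / b%:R) / (lam * T%:R) <= 30 * (beta / b%:R) / (lam * T%:R).
  by rewrite ler_wpM2r ?invr_ge0 ?mulr_ge0 ?(ltW l0) ?(ltW t0) // ler_wpM2r // ler_nat.
lra.
Qed.
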